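(* The CP rank $r_{CP}:\mathbf{T}\to\mathbf{Z}_+$ is a subadditive tensor rank function. It is not a proper tensor rank function.
   Context: $\mathbf{Z}_+$ is the set of nonnegative integers and $\mathbf{N}$ the set of positive integers. For $m,n_1,\dots,n_m\in\mathbf{N}$, $\mathbf{T}(n_1,\dots,n_m)$ is the set of real $m$th order tensors $\mathcal{X}=(x_{i_1\cdots i_m})$ of dimension $n_1\times\cdots\times n_m$; $\mathbf{CT}(m,n)$ is the case $n_1=\cdots=n_m=n$; $\mathbf{T}$ is the set of all real tensors (all orders $m\ge1$, all dimensions). A tensor $\mathcal{X}\in\mathbf{T}(n_1,\dots,n_m)$ is rank-one if $\mathcal{X}=\mathbf{x}^{(1)}\circ\cdots\circ\mathbf{x}^{(m)}$ (outer product) with nonzero $\mathbf{x}^{(i)}\in\mathbb{R}^{n_i}$. The identity tensor $\mathcal{I}_{m,n}\in\mathbf{CT}(m,n)$ has entries $1$ when $i_1=\cdots=i_m$ and $0$ otherwise. A subtensor of $\mathcal{X}\in\mathbf{T}(n_1,\dots,n_m)$ is a tensor of the same order $m$ obtained by choosing nonempty index sets $T_l\subseteq\{1,\dots,n_l\}$, $l=1,\dots,m$, and restricting $\mathcal{X}$ to $T_1\times\cdots\times T_m$; it is an element of $\mathbf{T}(|T_1|,\dots,|T_m|)$. A function $r:\mathbf{T}\to\mathbf{Z}_+$ is a tensor rank function if: (1) $r(\mathcal{X})=0$ iff $\mathcal{X}$ is a zero tensor, and $r(\mathcal{X})=1$ iff $\mathcal{X}$ is a rank-one tensor; (2) $r(\mathcal{I}_{m,n})=n$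 for all $m,n\in\mathbf{N}$ with $m\ge2$; (3) for $\mathcal{X}\in\mathbf{T}(n_1,n_2,1,\dots,1)$ (order at least $2$), $r(\mathcal{X})$ equals the matrix rank of the $n_1\times n_2$ matrix corresponding to $\mathcal{X}$; (4) $r(\alpha\mathcal{X})=r(\mathcal{X})$ for every tensor $\mathcal{X}$ and real $\alpha\ne0$; (5) $r(\mathcal{Y})=r(\mathcal{X})$ whenever $\mathcal{Y}$ is obtained from $\mathcal{X}$ by permuting its modes, i.e. $\sigma$ is a permutation of the $m$ coordinates, $\mathcal{Y}$ has dimensions $\sigma(n_1,\dots,n_m)$, and the entry of $\mathcal{Y}$ at position $\sigma(i_1,\dots,i_m)$ is $x_{i_1\cdots i_m}$; (6) $r(\mathcal{Y})\le r(\mathcal{X})$ whenever $\mathcal{Y}$ is a subtensor of $\mathcal{X}$. A tensor rank function $r$ is proper if $r(\mathcal{X})\le n$ for all $m,n\in\mathbf{N}$ and $\mathcal{X}\in\mathbf{CT}(m,n)$. It is subadditive if $r(\mathcal{X}+\mathcal{Y})\le r(\mathcal{X})+r(\mathcal{Y})$ for all $m,n_1,\dots,n_m\in\mathbf{N}$ and $\mathcal{X},\mathcal{Y}\in\mathbf{T}(n_1,\dots,n_m)$. CP rank: for $\mathcal{X}\in\mathbf{T}(n_1,\dots,n_m)$, $r_{CP}(\mathcal{X})$ is the smallest integer $r\ge0$ such that $\mathcal{X}=\sum_{p=1}^r\mathbf{a}^{(1,p)}\circ\cdots\circ\mathbf{a}^{(m,p)}$ for some vectors $\mathbf{a}^{(i,p)}\in\mathbb{R}^{n_i}$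 (the empty sum, $r=0$, being the zero tensor). *)

(* Defs.v *)
From HB Require Import structures.
From mathcomp Require Import all_boot all_order all_algebra perm.
From mathcomp Require Import boolp reals.

Set Implicit Arguments.
Unset Strict Implicit.
Unset Printing Implicit Defensive.

Import Order.TTheory GRing.Theory Num.Theory.
Local Open Scope ring_scope.

(* Orders are positive by typing: a tensor of order m.+1 has dimensions
   n : 'I_m.+1 -> nat.  Positivity of the dimensions is the separate predicate
   pos_dims, which guards every condition on rank functions below, so that the
   values of a rank function on tensors with a zero dimension are irrelevant. *)

Definition tindex m (n : 'I_m.+1 -> nat) : finType :=
  {dffun forall i : 'I_m.+1, 'I_(n i)}.

Definition tensor (R : realType) m (n : 'I_m.+1 -> nat) :=
  {ffun tindex n -> R}.

Definition pos_dims m (n : 'I_m.+1 -> nat) := forall i, (0 < n i)%N.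

Definition cubic_dims m (n : nat) : 'I_m.+1 -> nat := fun=> n.
Arguments cubic_dims : clear implicits.

Definition outer (R : realType) m (n : 'I_m.+1 -> nat)
    (x : forall i, 'rV[R]_(n i)) : tensor R n :=
  [ffun t : tindex n => \prod_i x i 0 (t i)].

Definition rank_one (R : realType) m (n : 'I_m.+1 -> nat) (X : tensor R n) :=
  exists2 x : forall i, 'rV[R]_(n i), (forall i, x i != 0) & X = outer x.

Definition scale_tensor (R : realType) m (n : 'I_m.+1 -> nat) (a : R)
    (X : tensor R n) : tensor R n :=
  [ffun t : tindex n => a * X t].

Definition id_tensor (R : realType) m n : tensor R (cubic_dims m n) :=
  [ffun t : tindex (cubic_dims m n) => [forall i, forall j, t i == t j]%:R].

(* mxdims are the dimensions (n1, n2, 1, ..., 1); mxindex i j is the only index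
   with first two coordinates i and j. *)
Definition mxdim (n1 n2 k : nat) : nat :=
  match k with 0 => n1 | 1 => n2 | _ => 1 end.

Definition mxdims m n1 n2 : 'I_m.+2 -> nat := fun k => mxdim n1 n2 k.
Arguments mxdims : clear implicits.

Definition mxindex m n1 n2 (i : 'I_n1) (j : 'I_n2) : tindex (mxdims m n1 n2) :=
  [ffun k : 'I_m.+2 =>
     match val k as v return 'I_(mxdim n1 n2 v) with
     | 0 => i
     | 1 => j
     | _ => ord0
     end].

Definition tensor_mx (R : realType) m n1 n2 (X : tensor R (mxdims m n1 n2)) :
    'M[R]_(n1, n2) :=
  \matrix_(i, j) X (mxindex m i j).

Definition perm_dims m (s : 'S_m.+1) (n : 'I_m.+1 -> nat) : 'I_m.+1 -> nat :=
  fun i => n (s i).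

Definition perm_index m (s : 'S_m.+1) (n : 'I_m.+1 -> nat) (t : tindex n) :
    tindex (perm_dims s n) :=
  [ffun i : 'I_m.+1 => t (s i)].

Definition permuted_modes (R : realType) m (s : 'S_m.+1) (n : 'I_m.+1 -> nat)
    (X : tensor R n) (Y : tensor R (perm_dims s n)) :=
  forall t : tindex n, Y (perm_index s t) = X t.

(* enum_val lists the elements of T l in increasing order. *)
Definition subtensor (R : realType) m (n : 'I_m.+1 -> nat)
    (T : forall l, {set 'I_(n l)}) (X : tensor R n) :
    tensor R (fun l => #|T l|) :=
  [ffun t : tindex (fun l => #|T l|) =>
     X [ffun l : 'I_m.+1 => enum_val (t l)]].

Definition rank_fun (R : realType) :=
  forall m (n : 'I_m.+1 -> nat), tensor R n -> nat.

Record tensor_rank_function (R : realType) (r : rank_fun R) : Prop := {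
  trf_zero : forall m (n : 'I_m.+1 -> nat) (X : tensor R n), pos_dims n ->
    r m n X = 0%N <-> X = 0;
  trf_one : forall m (n : 'I_m.+1 -> nat) (X : tensor R n), pos_dims n ->
    r m n X = 1%N <-> rank_one X;
  trf_id : forall m n, (0 < n)%N ->
    r m.+1 (cubic_dims m.+1 n) (id_tensor R m.+1 n) = n;
  trf_matrix : forall m n1 n2 (X : tensor R (mxdims m n1 n2)),
    (0 < n1)%N -> (0 < n2)%N ->
    r m.+1 (mxdims m n1 n2) X = \rank (tensor_mx X);
  trf_scale : forall m (n : 'I_m.+1 -> nat) (X : tensor R n) (a : R),
    pos_dims n -> a != 0 -> r m n (scale_tensor a X) = r m n X;
  trf_perm : forall m (n : 'I_m.+1 -> nat) (s : 'S_m.+1)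
      (X : tensor R n) (Y : tensor R (perm_dims s n)),
    pos_dims n -> permuted_modes X Y -> r m (perm_dims s n) Y = r m n X;
  trf_sub : forall m (n : 'I_m.+1 -> nat) (T : forall l, {set 'I_(n l)})
      (X : tensor R n),
    pos_dims n -> (forall l, T l != set0) ->
    (r m (fun l => #|T l|) (subtensor T X) <= r m n X)%N
}.

Definition proper_rank (R : realType) (r : rank_fun R) :=
  forall m n (X : tensor R (cubic_dims m n)), (0 < n)%N ->
    (r m (cubic_dims m n) X <= n)%N.

Definition subadditive_rank (R : realType) (r : rank_fun R) :=
  forall m (n : 'I_m.+1 -> nat) (X Y : tensor R n), pos_dims n ->
    (r m n (X + Y)%R <= r m n X + r m n Y)%N.

Definition cp_decomposable (R : realType) m (n : 'I_m.+1 -> nat)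
    (X : tensor R n) (k : nat) : Prop :=
  exists a : 'I_k -> forall i, 'rV[R]_(n i), X = \sum_(p < k) outer (a p).

Lemma cp_decomposable_ex (R : realType) m (n : 'I_m.+1 -> nat)
    (X : tensor R n) : exists k, `[< cp_decomposable X k >].
Proof.
exists #|tindex n|; apply/asboolP.
exists (fun p i => (if i == ord0 then X (enum_val p) else 1)
                   *: delta_mx 0 ((enum_val p : tindex n) i)).
apply/ffunP => t; rewrite sum_ffunE.
rewrite (bigD1 (enum_rank t)) //= big1 ?addr0 => [|p npt].
  rewrite ffunE (bigD1 ord0) //= enum_rankK !mxE !eqxx mulr1 big1 ?mulr1 //.
  by move=> i /negbTE ->; rewrite !mxE !eqxx mulr1.
rewrite ffunE.
have /existsP[i ni] : [exists i, t i != (enum_val p : tindex n) i].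
  rewrite -negb_forall; apply: contra npt => /forallP h.
  suff -> : t = enum_val p by rewrite enum_valK.
  by apply/ffunP => i; apply/eqP.
by rewrite (bigD1 i) //= !mxE (negbTE ni) andbF mulr0 mul0r.
Qed.

Definition cp_rank (R : realType) : rank_fun R :=
  fun m n X => ex_minn (cp_decomposable_ex X).

(* Main.v *)
(** Lower bounds on the CP rank come from flattenings: splitting the modes into
two groups turns a sum of k rank-one tensors into a product of a matrix with k
columns and a matrix with k rows, whose rank is at most k.  This gives the
values on identity tensors and on matrices.  The order 4 tensor of dimension 2
with entries [i0 = i2][i1 = i3] flattens to the identity matrix of size 4, so
its CP rank exceeds 2 and the CP rank is not proper. *)

Require Import Defs.
From mathcomp Require Import all_boot all_order all_algebra perm.
From mathcomp Require Import boolp reals.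

Set Implicit Arguments.
Unset Strict Implicit.
Unset Printing Implicit Defensive.

Import Order.TTheory GRing.Theory Num.Theory.
Local Open Scope ring_scope.

(** Serves to undo a permutation of modes: [g (s^-1 i)] has type [F (s (s^-1 i))], which becomes
    [F i] only after a cast along [permKV]. *)
Lemma perm_dep_fun (I : finType) (s : {perm I}) (F : I -> Type)
    (g : forall i, F (s i)) :
  exists f : forall i, F i, forall i, f (s i) = g i.
Proof.
exists (fun i => ecast z (F z) (permKV s i) (g (s^-1%g i))) => i.
(* With [s^-1 (s i)] generalized to any [j] such that [s j = s i], injectivity identifies [j] with
   [i], and the cast is along a proof of [s i = s i], hence trivial. *)
move: (permKV s (s i)); move: (s^-1%g (s i)) => j e.
have ji := perm_inj e; subst j.
by rewrite eq_axiomK.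
Qed.

Section CPRank.
Variable R : realType.

Section FixedDimensions.
Variables (m : nat) (n : 'I_m.+1 -> nat).
Implicit Types (X Y : tensor R n) (x : forall i, 'rV[R]_(n i)).

Lemma cp_rank_decomposable X : cp_decomposable X (cp_rank X).
Proof. by rewrite /cp_rank; case: ex_minnP => k /asboolP. Qed.

Lemma cp_rank_le X k : cp_decomposable X k -> (cp_rank X <= k)%N.
Proof.
by move=> Xk; rewrite /cp_rank; case: ex_minnP => j _; apply; apply/asboolP.
Qed.

Lemma cp_decomposableP X k :
  cp_decomposable X k <-> exists a : 'I_k -> forall i, 'rV[R]_(n i),
    forall t, X t = \sum_(p < k) \prod_i a p i 0 (t i).
Proof.
split=> [[a ->]|[a Xa]]; exists a.
  by move=> t; rewrite sum_ffunE; apply: eq_bigr => p _; rewrite ffunE.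
by apply/ffunP => t; rewrite Xa sum_ffunE; apply: eq_bigr => p _; rewrite ffunE.
Qed.

Lemma cp_rank_eq0 X : cp_rank X = 0%N <-> X = 0.
Proof.
split=> [X0|->].
  by have := cp_rank_decomposable X; rewrite X0 => -[a ->]; rewrite big_ord0.
apply/eqP; rewrite -leqn0; apply: cp_rank_le.
by exists (fun _ _ => 0); rewrite big_ord0.
Qed.

Lemma outer_neq0 x : outer x <> 0 <-> (forall i, x i != 0).
Proof.
split=> [x0 i|x0 /ffunP ox0].
  apply/eqP => xi0; apply: x0; apply/ffunP => t.
  by rewrite !ffunE (bigD1 i) //= xi0 mxE mul0r.
(* Choosing a nonzero coordinate of each vector gives a position whose entry is a product of nonzero
   factors. *)
pose ex i := rV0Pn _ (x0 i).
have := ox0 [ffun i => xchoose (ex i)]; rewrite !ffunE => /eqP.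
by apply/negP/prodf_neq0 => i _; rewrite ffunE; exact: (xchooseP (ex i)).
Qed.

Lemma cp_rank_eq1 X : cp_rank X = 1%N <-> rank_one X.
Proof.
split=> [X1|[x x0 Xx]].
  have := cp_rank_decomposable X; rewrite X1 => -[a].
  rewrite big_ord1 => Xa; exists (a ord0) => //; apply/outer_neq0.
  by rewrite -Xa => /cp_rank_eq0; rewrite X1.
apply/eqP; rewrite eqn_leq lt0n; apply/andP; split.
  by apply: cp_rank_le; exists (fun=> x); rewrite big_ord1.
by apply/eqP => /cp_rank_eq0; rewrite Xx; apply/outer_neq0.
Qed.

(** Each rank-one term splits at a position into a factor over the modes in [P], depending on [i]
    only, and one over the other modes, depending on [j] only. The families [u] and [v] select rows
    and columns of the flattening; the coordinates of [u i] outside [P] and of [v j] inside [P] are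
    ignored. *)
Lemma rank_flattening_le X (P : pred 'I_m.+1) a b
    (u : 'I_a -> tindex n) (v : 'I_b -> tindex n) :
  (\rank (\matrix_(i, j) X [ffun l => if P l then u i l else v j l])
    <= cp_rank X)%N.
Proof.
have /cp_decomposableP[c Xc] := cp_rank_decomposable X.
set M := \matrix_(_, _) _.
have -> : M = (\matrix_(i, p) \prod_(l | P l) c p l 0 (u i l))
      *m (\matrix_(p, j) \prod_(l | ~~ P l) c p l 0 (v j l)).
  apply/matrixP => i j; rewrite !mxE Xc; apply: eq_bigr => p _.
  rewrite !mxE (bigID P) /=.
  by congr (_ * _); apply: eq_bigr => l Pl; rewrite ffunE ?Pl ?(negbTE Pl).
exact: leq_trans (mxrankM_maxl _ _) (rank_leq_col _).
Qed.

Lemma cp_rank_scale_le X (a : R) : (cp_rank (scale_tensor a X) <= cp_rank X)%N.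
Proof.
have /cp_decomposableP[c Xc] := cp_rank_decomposable X.
apply: cp_rank_le; apply/cp_decomposableP.
(* The scalar must enter each product exactly once, so mode 0 alone absorbs it. *)
exists (fun p i => (if i == ord0 then a else 1) *: c p i) => t.
rewrite ffunE Xc big_distrr /=; apply: eq_bigr => p _.
rewrite (bigD1 ord0) //= [RHS](bigD1 ord0) //= mxE mulrA; congr (_ * _).
by apply: eq_bigr => i /negbTE i0; rewrite i0 scale1r.
Qed.

Lemma cp_rank_scale X (a : R) :
  a != 0 -> cp_rank (scale_tensor a X) = cp_rank X.
Proof.
move=> a0; apply/eqP; rewrite eqn_leq cp_rank_scale_le /=.
have {1}-> : X = scale_tensor a^-1 (scale_tensor a X).
  by apply/ffunP => t; rewrite !ffunE mulKf.
exact: cp_rank_scale_le.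
Qed.

Lemma cp_rank_add X Y : (cp_rank (X + Y)%R <= cp_rank X + cp_rank Y)%N.
Proof.
have [[a Xa] [b Yb]] := (cp_rank_decomposable X, cp_rank_decomposable Y).
apply: cp_rank_le.
(* The two decompositions are concatenated. *)
exists (fun p => match split p with inl q => a q | inr q => b q end).
rewrite big_split_ord {1}Xa {1}Yb /=; congr (_ + _); apply: eq_bigr => p _.
  by case: (split (lshift _ p)) (splitK (lshift (cp_rank Y) p)) => q /=
    => [/lshift_inj ->|/eqP]; rewrite ?eq_rlshift.
by case: (split (rshift _ p)) (splitK (rshift (cp_rank X) p)) => q /=
    => [/eqP|/rshift_inj ->]; rewrite ?eq_lrshift.
Qed.

End FixedDimensions.

Lemma cp_rank_perm m (n : 'I_m.+1 -> nat) (s : 'S_m.+1) (X : tensor R n)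
    (Y : tensor R (perm_dims s n)) :
  permuted_modes X Y -> cp_rank Y = cp_rank X.
Proof.
move=> XY; apply/eqP; rewrite eqn_leq; apply/andP; split.
  have /cp_decomposableP[a Xa] := cp_rank_decomposable X.
  apply: cp_rank_le; apply/cp_decomposableP; exists (fun p i => a p (s i)) => t.
  have [f ft] := @perm_dep_fun _ s (fun i => 'I_(n i)) t.
  have -> : t = perm_index s [ffun i => f i].
    by apply/ffunP => i; rewrite !ffunE ft.
  rewrite XY Xa; apply: eq_bigr => p _.
  by rewrite (reindex_perm s) /=; apply: eq_bigr => i _; rewrite !ffunE.
have /cp_decomposableP[b Yb] := cp_rank_decomposable Y.
(* The family takes values in functions of [p], so that the vectors of all terms are pulled back at
   once. *)
have [a ab] := @perm_dep_fun _ s (fun i => 'I_(cp_rank Y) -> 'rV[R]_(n i))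
                             (fun i p => b p i).
apply: cp_rank_le; apply/cp_decomposableP; exists (fun p i => a i p) => t.
rewrite -XY Yb; apply: eq_bigr => p _.
by rewrite [RHS](reindex_perm s) /=; apply: eq_bigr => i _; rewrite ffunE ab.
Qed.

Lemma cp_rank_subtensor m (n : 'I_m.+1 -> nat)
    (T : forall l, {set 'I_(n l)}) (X : tensor R n) :
  (cp_rank (subtensor T X) <= cp_rank X)%N.
Proof.
have /cp_decomposableP[a Xa] := cp_rank_decomposable X.
apply: cp_rank_le; apply/cp_decomposableP.
exists (fun p l => \row_j a p l 0 (enum_val j)) => t.
rewrite ffunE Xa; apply: eq_bigr => p _.
by apply: eq_bigr => i _; rewrite ffunE mxE.
Qed.

Lemma cp_rank_id m n : cp_rank (id_tensor R m.+1 n) = n.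
Proof.
apply/eqP; rewrite eqn_leq; apply/andP; split.
  (* The identity tensor is the sum of the outer powers of the basis vectors; at [t] only the term
     [p = t ord0] can survive. *)
  apply: cp_rank_le; apply/cp_decomposableP; exists (fun p _ => delta_mx 0 p) => t.
  rewrite ffunE (bigD1 (t ord0)) //= [X in _ + X]big1 ?addr0 => [|p pt]; last first.
    by rewrite (bigD1 ord0) //= mxE eqxx eq_sym (negbTE pt) mul0r.
  case: (altP forallP) => [h|/forallPn[i /forallPn[j ij]]].
    by rewrite big1 // => i _; rewrite mxE eqxx (eqP (forallP (h i) ord0)) eqxx.
  have [l tl] : exists l, t l != t ord0.
    by have [ti|] := eqVneq (t i) (t ord0); [exists j; rewrite -ti eq_sym | exists i].
  by rewrite (bigD1 l) //= mxE (negbTE tl) andbF mul0r.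
(* Mode 0 is flattened against all the others, at constant positions. The order is at least 2, so
   [ord_max] lies among the others and forces [i = j] on a nonzero entry. *)
pose c (i : 'I_n) : tindex (cubic_dims m.+1 n) := [ffun=> i].
have := rank_flattening_le (id_tensor R m.+1 n) (pred1 ord0) c c.
set M := \matrix_(_, _) _; suff -> : M = 1%:M by rewrite mxrank1.
apply/matrixP => i j; rewrite !mxE ffunE; congr (_%:R).
congr nat_of_bool; apply/idP/eqP=> [/forallP/(_ ord0)/forallP/(_ ord_max)|->].
  by rewrite !ffunE /= => /eqP.
by apply/forallP => k; apply/forallP => l; rewrite !ffunE !if_same.
Qed.

Lemma mxindex_surj m n1 n2 (t : tindex (mxdims m n1 n2)) :
  exists i j, t = mxindex m i j.
Proof.
exists (t ord0), (t (Ordinal (isT : (1 < m.+2)%N))).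
apply/ffunP => -[[|[|k]] lk]; rewrite ffunE /=.
- by rewrite (bool_irrelevance lk (ltn0Sn m.+1)).
- by rewrite (bool_irrelevance lk isT).
- exact: ord1.
Qed.

Lemma cp_rank_mx m n1 n2 (X : tensor R (mxdims m n1 n2)) :
  (0 < n1)%N -> (0 < n2)%N -> cp_rank X = \rank (tensor_mx X).
Proof.
move=> n1_gt0 n2_gt0; apply/eqP; rewrite eqn_leq; apply/andP; split; last first.
  (* These only fill the coordinates that the flattening ignores. *)
  pose i0 := Ordinal n1_gt0; pose j0 := Ordinal n2_gt0.
  have := rank_flattening_le X (pred1 ord0)
            (fun i => mxindex m i j0) (fun j => mxindex m i0 j).
  set M := \matrix_(_, _) _; suff -> : M = tensor_mx X by [].
  apply/matrixP => i j; rewrite !mxE; congr (X _).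
  by apply/ffunP => -[[|[|k]] lk]; rewrite !ffunE.
apply: cp_rank_le; apply/cp_decomposableP.
(* A rank factorization: the columns of [col_base] go in mode 0, the rows of [row_base] in mode 1,
   and the scalar 1 in every mode of dimension 1 that follows. *)
exists (fun p (k : 'I_m.+2) =>
  match val k as v return 'rV[R]_(mxdim n1 n2 v) with
  | 0 => \row_i col_base (tensor_mx X) i p
  | 1 => row p (row_base (tensor_mx X))
  | _ => 1
  end) => t.
have [i [j ->]] := mxindex_surj t.
have -> : X (mxindex m i j) = tensor_mx X i j by rewrite mxE.
rewrite -[in LHS](mulmx_base (tensor_mx X)) mxE; apply: eq_bigr => p _.
rewrite !big_ord_recl big1 => [|k _]; rewrite !ffunE /= !mxE ?mulr1 //.
Qed.

Lemma cp_rank_not_proper : ~ proper_rank (@cp_rank R).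
Proof.
pose i0 : 'I_4 := inord 0; pose i1 : 'I_4 := inord 1.
pose i2 : 'I_4 := inord 2; pose i3 : 'I_4 := inord 3.
pose X : tensor R (cubic_dims 3 2) :=
  [ffun t : tindex (cubic_dims 3 2) => ((t i0 == t i2) && (t i1 == t i3))%:R].
move=> /(_ 3 2 X isT); apply/negP; rewrite -ltnNge.
(* The two binary digits of [i], the low one in modes 0 and 2, the high one in modes 1 and 3. Rows
   read modes 0 and 1, columns modes 2 and 3, so an entry is 1 exactly when both digits agree. *)
pose u (i : 'I_4) : tindex (cubic_dims 3 2) :=
  [ffun l : 'I_4 => if odd l then inord (i %/ 2) else inord (i %% 2)].
have := rank_flattening_le X (fun l : 'I_4 => (l < 2)%N) u u.
set M := \matrix_(_, _) _; suff -> : M = 1%:M by rewrite mxrank1; apply: ltn_trans.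
apply/matrixP => i j; rewrite !mxE !ffunE !inordK //=.
congr (_%:R); congr nat_of_bool.
rewrite -!val_eqE /= !inordK ?ltn_mod ?ltn_divLR ?ltn_ord //.
by move: i j => [[|[|[|[|//]]]] ?] [[|[|[|[|//]]]] ?].
Qed.

End CPRank.

Theorem theorem3p2 (R : realType) :
  (tensor_rank_function (@cp_rank R) /\ subadditive_rank (@cp_rank R)) /\
  ~ proper_rank (@cp_rank R).
Proof.
split; last exact: cp_rank_not_proper.
split=> [|m n X Y _]; last exact: cp_rank_add.
split.
- by move=> m n X _; exact: cp_rank_eq0.
- by move=> m n X _; exact: cp_rank_eq1.
- by move=> m n _; exact: cp_rank_id.
- exact: cp_rank_mx.
- by move=> m n X a _; exact: cp_rank_scale.
- by move=> m n s X Y _; exact: cp_rank_perm.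
- by move=> m n T X _ _; exact: cp_rank_subtensor.
Qed.
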